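(* Let $A\in\mathbb{C}^{m\times n}$ have the singular value decomposition $A=USV^H$, where $U\in\mathbb{C}^{m\times k}$, $V\in\mathbb{C}^{n\times k}$, $S\in\mathbb{R}^{k\times k}$ and $\operatorname{rank}(A)<k<\min(m,n)$. Then the following relationships between the differentials $dU,dS,dV$ and $dA$ hold: $$dU = U\left(F\odot[U^H dA\,V S+S V^H dA^H U]+T\odot [U^H dA\,V]\right)+(I_m-UU^H)\,dA\,V S^{-1},$$ $$dS = I_k \odot [U^H dA\,V],$$ $$dV = V\left(F\odot[S U^H dA\,V+V^H dA^H U S]\right)+(I_n-VV^H)\,dA^H U S^{-1},$$ where, with $\sigma_1,\dots,\sigma_k$ denoting the diagonal entries of $S$, $F$ and $T$ are the $k\times k$ matrices with entries $$F_{ij}=\begin{cases}0, &\sigma_i=\sigma_j,\\ \dfrac{1}{\sigma_j^2-\sigma_i^2}, &\text{otherwise},\end{cases}\qquad T_{ij}=\begin{cases}\dfrac{1}{\sigma_i}, &\sigma_i=\sigma_j\neq 0 \text{ and } i\neq j,\\ 0, &\text{otherwise},\end{cases}$$ and $S^{-1}$ is the $k\times k$ diagonal matrix whose $i$-th diagonal entry is $1/\sigma_i$ if $\sigma_i\neq 0$ and $0$ if $\sigma_i=0$.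
   Context: In the singular value decomposition $A=USV^H$, the matrices $U$ and $V$ have orthonormal columns, $U^HU=V^HV=I_k$, and $S=\operatorname{diag}(\sigma_1,\dots,\sigma_k)$ is the real diagonal matrix of singular values (some of which may be zero or repeated). $I_r$ is the $r\times r$ identity matrix, $(\cdot)^H$ is the conjugate transpose, and $\odot$ is the Hadamard (entrywise) product. $dA,dU,dS,dV$ denote the total differentials of $A,U,S,V$, with $dS$ diagonal; they are related by differentiating the defining relations $A=USV^H$ and $U^HU=V^HV=I_k$, i.e. $dA=dU\,SV^H+U\,dS\,V^H+US\,dV^H$ and $dU^HU+U^HdU=dV^HV+V^HdV=0$. Here $dA^H$, $dU^H$, $dV^H$ mean $(dA)^H$, $(dU)^H$, $(dV)^H$.
   Formalization: The formulas are shown to hold exactly when V^H dV vanishes where σ_i=σ_j, U^H dU vanishes on the diagonal and where σ_i=σ_j=0, and (I-UU^H)dU, (I-VV^H)dV vanish in columns with σ_j=0; without this they fail (dA=0, dS=0, dU=iU, dV=iV). *)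

(* Defs.v *)
From HB Require Import structures.
From mathcomp Require Import all_boot all_order all_algebra.

Set Implicit Arguments.
Unset Strict Implicit.
Unset Printing Implicit Defensive.

Import Order.TTheory GRing.Theory Num.Theory.
Local Open Scope ring_scope.
Local Open Scope sesquilinear_scope.

(* The complex numbers are an arbitrary [C : numClosedFieldType], whose real
   elements are those of [Num.real]; [M^t*] is the conjugate transpose. *)

Notation hadamard := (map2_mx *%R).

Section SVD.
Variables (C : numClosedFieldType) (m n k : nat).
Implicit Types (A dA : 'M[C]_(m, n)) (U dU : 'M[C]_(m, k)).
Implicit Types (V dV : 'M[C]_(n, k)) (S dS : 'M[C]_k).

(* [0 <= S i i] in [C] entails that [S i i] is real.  No ordering of the
   singular values is imposed. *)
Definition is_svd A U S V : Prop :=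
  [/\ A = U *m S *m V^t*,
      U^t* *m U = 1%:M,
      V^t* *m V = 1%:M,
      is_diag_mx S
    & forall i, 0 <= S i i].

(* The relations obtained by differentiating those of [is_svd].  Since [S]
   stays real and diagonal, so does its differential. *)
Definition svd_differential U S V dA dU dS dV : Prop :=
  [/\ dA = dU *m S *m V^t* + U *m dS *m V^t* + U *m S *m dV^t*,
      dU^t* *m U + U^t* *m dU = 0,
      dV^t* *m V + V^t* *m dV = 0,
      is_diag_mx dS
    & forall i, dS i i \is Num.real].

(* [svd_differential] does not determine [dU] and [dV] from [dA]: adding
   [U *m K] to [dU] and [V *m K] to [dV] preserves it for every skew-Hermitian
   [K] that commutes with [S], for instance [K = 'i%:M], and the left
   and right singular vectors of the singular value 0 vary independently.  The components left free are
   set to 0 here: those of [V^t* *m dV] within equal singular values, those of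
   [U^t* *m dU] on the diagonal and within the singular value 0, and those of
   the singular vectors of the singular value 0 orthogonal to the columns of
   [U] and [V].  Within equal nonzero singular values, [U^t* *m dU] off the
   diagonal is then determined by [dA], and given by [svdT]. *)
Definition svd_gauge U S V dU dV : Prop :=
  [/\ forall i j, S i i = S j j -> (V^t* *m dV) i j = 0,
      forall i j, S i i = S j j -> i = j \/ S i i = 0 ->
        (U^t* *m dU) i j = 0,
      forall j, S j j = 0 -> col j ((1%:M - U *m U^t*) *m dU) = 0
    & forall j, S j j = 0 -> col j ((1%:M - V *m V^t*) *m dV) = 0].

Definition svdF S : 'M[C]_k :=
  \matrix_(i, j) if S i i == S j j then 0 else 1 / (S j j ^+ 2 - S i i ^+ 2).

Definition svdT S : 'M[C]_k :=
  \matrix_(i, j)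
    if [&& S i i == S j j, S i i != 0 & i != j] then 1 / S i i else 0.

(* A pseudo-inverse: [S] is singular here. *)
Definition svdSinv S : 'M[C]_k :=
  diag_mx (\row_i if S i i != 0 then 1 / S i i else 0).

End SVD.

(* Main.v *)
Require Import Defs.
From HB Require Import structures.
From mathcomp Require Import all_boot all_order all_algebra.
From mathcomp Require Import ring.

Import Order.TTheory GRing.Theory Num.Theory.
Local Open Scope ring_scope.
Local Open Scope sesquilinear_scope.

(** The columns of [U] and [V] are orthonormal frames, so a differential [dU]
    splits as [U *m (U^t* *m dU)] plus a part orthogonal to the columns of
    [U], and likewise for [dV].  Put [W := U^t* *m dU] and
    [Y := V^t* *m dV], which are skew-Hermitian, and [P := U^t* *m dA *m V].
    Compressing the product rule for [dA] between [U^t*] and [V] gives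
    [P = W S + dS - S Y]; with the projection onto the orthogonal complement
    of the columns of [U] in place of [U^t*], only the part of [dU S] in that
    complement survives ([svd_differential_compl]).

    The first equation is read entry by entry ([svd_differential_core]).
    - If [s_i <> s_j], the combinations of [P] and [P^t*] weighted by [S]
      isolate [(s_j^2 - s_i^2) W_ij] and [(s_j^2 - s_i^2) Y_ij]; the factor is
      nonzero because singular values are nonnegative.  This is the role of
      [svdF] ([hadamard_svdF]).
    - If [s_i = s_j <> 0] and [i <> j], the entry is [s_i (W_ij - Y_ij)], so
      only a difference is determined, and the gauge [Y_ij = 0] makes it
      [W_ij]: this is [svdT].
    - On the diagonal the gauge leaves [P_ii = dS_ii].
    The orthogonal parts are recovered by the pseudo-inverse of [S] in the
    columns with [s_j <> 0], and the gauge sets the other columns to 0.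
    The formula for [dV] follows from the facts about [dU] applied to the
    adjoint decomposition [A^t* = V S U^t*].

    Conversely, the formulas display [W], [Y] and the orthogonal parts of [dU]
    and [dV] directly: [svdF] vanishes within equal singular values, [svdT] on
    the diagonal and at the singular value 0, and the pseudo-inverse of [S] in
    the columns with [s_j = 0] ([svd_formula_gauge]).

    For existence, the given differential is moved into the gauge without
    changing [dA]: off the diagonal, [Y_ij] is transferred to [W_ij] within
    equal nonzero singular values, and both are erased within the singular
    value 0; on the diagonal both are erased and [dS] becomes the diagonal of
    [P], real by hypothesis ([svd_gauge_exists]). *)

(** * Adjoints, diagonal factors and orthonormal frames *)

Section Frames.

Set Implicit Arguments.
Unset Strict Implicit.

Variable C : numClosedFieldType.

Lemma trmxC_mul m n p (M : 'M[C]_(m, n)) (N : 'M[C]_(n, p)) :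
  (M *m N)^t* = N^t* *m M^t*.
Proof. by rewrite trmx_mul map_mxM. Qed.

Lemma trmxCD m n (M N : 'M[C]_(m, n)) : (M + N)^t* = M^t* + N^t*.
Proof. by rewrite linearD /= map_mxD. Qed.

Lemma mulmx_diagE m n (M : 'M[C]_(m, n)) (D : 'M[C]_n) i j :
  is_diag_mx D -> (M *m D) i j = M i j * D j j.
Proof. by case/diag_mxP => d ->; rewrite mul_mx_diag !mxE eqxx. Qed.

Lemma diag_mulmxE m n (D : 'M[C]_m) (M : 'M[C]_(m, n)) i j :
  is_diag_mx D -> (D *m M) i j = D i i * M i j.
Proof. by case/diag_mxP => d ->; rewrite mul_diag_mx !mxE eqxx. Qed.

Lemma diag_real_trmxC n (D : 'M[C]_n) :
  is_diag_mx D -> (forall i, D i i \is Num.real) -> D^t* = D.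
Proof.
move=> /is_diag_mxP diagD realD; apply/matrixP => i j; rewrite !mxE.
have [-> | ij] := eqVneq i j; first exact/CrealP.
by rewrite !diagD ?rmorph0 // eq_sym.
Qed.

Lemma hadamard1_is_diag n (M : 'M[C]_n) : is_diag_mx (hadamard 1%:M M).
Proof.
by apply/is_diag_mxP => i j ij; rewrite !mxE -val_eqE /= (negPf ij) mul0r.
Qed.

Lemma hadamard1E n (M : 'M[C]_n) i : hadamard 1%:M M i i = M i i.
Proof. by rewrite !mxE eqxx mul1r. Qed.

Lemma mulmx_svdSinvE m k (M : 'M[C]_(m, k)) (S : 'M[C]_k) i j :
  (M *m svdSinv S) i j = if S j j != 0 then M i j / S j j else 0.
Proof.
rewrite /svdSinv mul_mx_diag !mxE.
by case: ifP => _; rewrite ?mulr0 // mul1r.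
Qed.

Lemma mulmx_diag_svdSinvE m k (M : 'M[C]_(m, k)) (S : 'M[C]_k) i j :
  is_diag_mx S ->
  (M *m S *m svdSinv S) i j = if S j j != 0 then M i j else 0.
Proof.
move=> diagS; rewrite mulmx_svdSinvE mulmx_diagE //.
by case: ifP => // Sj; rewrite mulfK.
Qed.

Lemma mulmx_diag_svdSinv_id m k (M : 'M[C]_(m, k)) (S : 'M[C]_k) :
  is_diag_mx S -> (forall j, S j j = 0 -> col j M = 0) ->
  M *m S *m svdSinv S = M.
Proof.
move=> diagS M0; apply/matrixP => i j; rewrite mulmx_diag_svdSinvE //.
case: eqP => //= /M0 /(congr1 (fun c : 'cV_m => c i 0)).
by rewrite !mxE.
Qed.

Lemma col_mulmx_svdSinv m k (M : 'M[C]_(m, k)) (S : 'M[C]_k) j :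
  S j j = 0 -> col j (M *m svdSinv S) = 0.
Proof.
move=> Sj; apply/colP => i.
by rewrite [LHS]mxE mulmx_svdSinvE Sj eqxx [RHS]mxE.
Qed.

Lemma mulmx_diag_svdSinvK m k (M : 'M[C]_(m, k)) (S : 'M[C]_k) :
  is_diag_mx S -> M *m S *m svdSinv S *m S = M *m S.
Proof.
move=> diagS; apply/matrixP => i j.
rewrite !(mulmx_diagE _ _ _ diagS) mulmx_diag_svdSinvE //.
by case: eqP => //= ->; rewrite !mulr0.
Qed.

Section OneFrame.

Variables (m k : nat) (U : 'M[C]_(m, k)).
Hypothesis orthU : U^t* *m U = 1%:M.

Lemma frame_split p (X : 'M[C]_(m, p)) :
  X = U *m (U^t* *m X) + (1%:M - U *m U^t*) *m X.
Proof. by rewrite mulmxBl mul1mx mulmxA addrCA subrr addr0. Qed.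

Lemma frame_compl_mul : (1%:M - U *m U^t*) *m U = 0.
Proof. by rewrite mulmxBl mul1mx -mulmxA orthU mulmx1 subrr. Qed.

Lemma frame_mul_compl : U^t* *m (1%:M - U *m U^t*) = 0.
Proof. by rewrite mulmxBr mulmx1 mulmxA orthU mul1mx subrr. Qed.

Lemma frame_compl_idem :
  (1%:M - U *m U^t*) *m (1%:M - U *m U^t*) = 1%:M - U *m U^t*.
Proof.
by rewrite [LHS]mulmxBr mulmx1 mulmxA frame_compl_mul mul0mx subr0.
Qed.

Lemma frame_coord p (X : 'M[C]_(k, p)) (Z : 'M[C]_(m, p)) :
  U^t* *m (U *m X + (1%:M - U *m U^t*) *m Z) = X.
Proof.
by rewrite mulmxDr !mulmxA orthU mul1mx frame_mul_compl mul0mx addr0.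
Qed.

Lemma frame_compl_coord p (X : 'M[C]_(k, p)) (Z : 'M[C]_(m, p)) :
  (1%:M - U *m U^t*) *m (U *m X + (1%:M - U *m U^t*) *m Z)
  = (1%:M - U *m U^t*) *m Z.
Proof.
by rewrite mulmxDr !mulmxA frame_compl_mul mul0mx add0r frame_compl_idem.
Qed.

Lemma frame_skewE (X : 'M[C]_(m, k)) :
  X^t* *m U + U^t* *m X = 0 <->
  forall i j, ((U^t* *m X) j i)^* = - (U^t* *m X) i j.
Proof.
have -> : X^t* *m U = (U^t* *m X)^t* by rewrite trmxC_mul trmxCK.
move: (U^t* *m X) => W; split=> [skewW i j | skewW].
  apply/eqP; rewrite -addr_eq0; apply/eqP.
  by have := congr1 (fun M : 'M_k => M i j) skewW; rewrite !mxE.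
by apply/matrixP => i j; rewrite [LHS]mxE [RHS]mxE 2!mxE skewW addNr.
Qed.

End OneFrame.

End Frames.

(** * What [dA] determines *)

Section Differential.

Set Implicit Arguments.
Unset Strict Implicit.

Variable C : numClosedFieldType.

(** Exchanges the roles of [U] and [V]: every fact proved about [dU] yields
    the corresponding fact about [dV]. *)
Lemma svd_differential_adj m n k (U : 'M[C]_(m, k)) (S : 'M[C]_k)
    (V : 'M[C]_(n, k)) (dA : 'M[C]_(m, n)) dU dS dV :
  is_diag_mx S -> (forall i, 0 <= S i i) ->
  svd_differential U S V dA dU dS dV ->
  svd_differential V S U (dA^t*) dV dS dU.
Proof.
move=> diagS posS [-> skewU skewV diagdS realdS].
have adjS : S^t* = S by apply: diag_real_trmxC => // i; rewrite ger0_real.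
split=> //; rewrite !trmxCD !trmxC_mul !trmxCK adjS (diag_real_trmxC diagdS) //.
by rewrite !mulmxA addrC addrA addrAC.
Qed.

Section Determined.

Variables (m n k : nat) (U : 'M[C]_(m, k)) (S : 'M[C]_k) (V : 'M[C]_(n, k)).
Hypotheses (orthU : U^t* *m U = 1%:M) (orthV : V^t* *m V = 1%:M).
Hypotheses (diagS : is_diag_mx S) (posS : forall i, 0 <= S i i).
Variables (dA : 'M[C]_(m, n)) (dU : 'M[C]_(m, k)) (dS : 'M[C]_k).
Variable dV : 'M[C]_(n, k).
Hypothesis dsvd : svd_differential U S V dA dU dS dV.

Lemma svd_differential_core :
  U^t* *m dA *m V = U^t* *m dU *m S + dS - S *m (V^t* *m dV).
Proof.
have [-> _ /eqP skewV _ _] := dsvd.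
rewrite !mulmxDr !mulmxDl !mulmxA orthU !mul1mx -!(mulmxA _ (V^t*) V) orthV.
rewrite !mulmx1; congr (_ + _).
move: skewV; rewrite addr_eq0 => /eqP skewV.
by rewrite -mulmxA skewV mulmxN mulmxA.
Qed.

Lemma svd_differential_coreE i j :
  (U^t* *m dA *m V) i j
  = (U^t* *m dU) i j * S j j + dS i j - S i i * (V^t* *m dV) i j.
Proof.
have entryE (X Y Z : 'M[C]_k) : (X + Y - Z) i j = X i j + Y i j - Z i j.
  by rewrite !mxE.
by rewrite svd_differential_core entryE mulmx_diagE // diag_mulmxE.
Qed.

Lemma svd_differential_compl :
  (1%:M - U *m U^t*) *m dA *m V = (1%:M - U *m U^t*) *m dU *m S.
Proof.
have [-> _ _ _ _] := dsvd.
have := frame_compl_mul orthU; move: (1%:M - _) => Q QU.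
rewrite !mulmxDr !mulmxDl !mulmxA QU !mul0mx !addr0.
by rewrite -[LHS]mulmxA orthV mulmx1.
Qed.

(** In [P S + S P^t*] the unknown [Y] cancels, because it is skew-Hermitian and
    enters as [- S Y]; what is left is [(s_j^2 - s_i^2) W_ij] off the
    diagonal. *)
Lemma hadamard_svdF i j :
  hadamard (svdF S) (U^t* *m dA *m V *m S + S *m V^t* *m dA^t* *m U) i j
  = if S i i == S j j then 0 else (U^t* *m dU) i j.
Proof.
have [_ /frame_skewE skewU /frame_skewE skewV diagdS _] := dsvd.
have -> : S *m V^t* *m dA^t* *m U = S *m (U^t* *m dA *m V)^t*.
  by rewrite !trmxC_mul trmxCK !mulmxA.
rewrite mxE [svdF S i j]mxE; case: eqP => [_ | /eqP Sij]; first by rewrite mul0r.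
have ij : i != j by apply: contraNneq Sij => ->.
have adjE (M : 'M[C]_k) : M^t* i j = (M j i)^* by rewrite !mxE.
rewrite [X in _ * X]mxE mulmx_diagE // diag_mulmxE // adjE.
rewrite !svd_differential_coreE.
rewrite !(is_diag_mxP diagdS) ?val_eqE // 1?eq_sym //.
rewrite !addr0 rmorphB !rmorphM /= skewU skewV.
rewrite !(geC0_conj (posS _)).
move: ((U^t* *m dU) i j) ((V^t* *m dV) i j) => w y.
have dS2 : S j j ^+ 2 - S i i ^+ 2 != 0.
  by rewrite subr_eq0 eqrXn2 // eq_sym.
rewrite mul1r; apply: (canLR (mulKf dS2)).
ring.
Qed.

(** Within equal nonzero singular values [P_ij = s_i (W_ij - Y_ij)], which is
    [s_i W_ij] once [Y] vanishes there. *)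
Lemma hadamard_svdT i j :
  (S i i = S j j -> (V^t* *m dV) i j = 0) ->
  hadamard (svdT S) (U^t* *m dA *m V) i j
  = if [&& S i i == S j j, S i i != 0 & i != j]
    then (U^t* *m dU) i j else 0.
Proof.
have [_ _ _ /is_diag_mxP diagdS _] := dsvd.
move=> Y0; rewrite mxE [svdT S i j]mxE; case: ifP => [|_]; last by rewrite mul0r.
case/and3P=> /eqP Sij Si ij; rewrite svd_differential_coreE Y0 // diagdS //.
by rewrite -Sij mulr0 subr0 addr0 mul1r mulrC mulfK.
Qed.

Lemma svd_differential_dS :
  (forall i, (U^t* *m dU) i i = 0) -> (forall i, (V^t* *m dV) i i = 0) ->
  dS = hadamard 1%:M (U^t* *m dA *m V).
Proof.
have [_ _ _ diagdS _] := dsvd.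
move=> W0 Y0; apply/matrixP => i j; have [<- | ij] := eqVneq i j.
  by rewrite hadamard1E svd_differential_coreE W0 Y0 mul0r mulr0 add0r subr0.
by rewrite (is_diag_mxP diagdS) // (is_diag_mxP (hadamard1_is_diag _)).
Qed.

Lemma svd_differential_compl_svdSinv :
  (forall j, S j j = 0 -> col j ((1%:M - U *m U^t*) *m dU) = 0) ->
  (1%:M - U *m U^t*) *m dA *m V *m svdSinv S = (1%:M - U *m U^t*) *m dU.
Proof.
by move=> dU0; rewrite svd_differential_compl mulmx_diag_svdSinv_id.
Qed.

End Determined.

(** * The gauge *)

Section Gauge.

Variables (m n k : nat) (U : 'M[C]_(m, k)) (S : 'M[C]_k) (V : 'M[C]_(n, k)).
Hypotheses (orthU : U^t* *m U = 1%:M) (orthV : V^t* *m V = 1%:M).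
Hypotheses (diagS : is_diag_mx S) (posS : forall i, 0 <= S i i).

Lemma svd_gauge_coord (W Y : 'M[C]_k) (L : 'M[C]_(m, k)) (N : 'M[C]_(n, k)) :
  (forall i j, S i i = S j j -> Y i j = 0) ->
  (forall i j, S i i = S j j -> i = j \/ S i i = 0 -> W i j = 0) ->
  svd_gauge U S V (U *m W + (1%:M - U *m U^t*) *m L *m svdSinv S)
                  (V *m Y + (1%:M - V *m V^t*) *m N *m svdSinv S).
Proof.
move=> Y0 W0; split=> [i j Sij | i j Sij ij | j Sj | j Sj].
- by rewrite -mulmxA frame_coord // Y0.
- by rewrite -mulmxA frame_coord // W0.
- by rewrite -mulmxA frame_compl_coord // mulmxA col_mulmx_svdSinv.
- by rewrite -mulmxA frame_compl_coord // mulmxA col_mulmx_svdSinv.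
Qed.

Variables (dA : 'M[C]_(m, n)) (dU : 'M[C]_(m, k)) (dS : 'M[C]_k).
Variable dV : 'M[C]_(n, k).
Hypothesis dsvd : svd_differential U S V dA dU dS dV.

Lemma svd_gauge_formula :
  svd_gauge U S V dU dV ->
  [/\ dU = U *m (hadamard (svdF S)
                   (U^t* *m dA *m V *m S + S *m V^t* *m dA^t* *m U)
                 + hadamard (svdT S) (U^t* *m dA *m V))
           + (1%:M - U *m U^t*) *m dA *m V *m svdSinv S,
      dS = hadamard 1%:M (U^t* *m dA *m V)
    & dV = V *m hadamard (svdF S)
                  (S *m U^t* *m dA *m V + V^t* *m dA^t* *m U *m S)
           + (1%:M - V *m V^t*) *m dA^t* *m U *m svdSinv S].
Proof.
case=> Y0 W0 compU0 compV0.
have dsvd' := svd_differential_adj diagS posS dsvd.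
split.
- rewrite (svd_differential_compl_svdSinv orthU orthV diagS dsvd compU0).
  rewrite {1}[dU](frame_split U); congr (U *m _ + _); apply/matrixP => i j.
  rewrite [RHS]mxE (hadamard_svdF orthU orthV diagS posS dsvd).
  rewrite (hadamard_svdT orthU orthV diagS dsvd (Y0 i j)).
  have [Sij | _] := eqVneq (S i i) (S j j); last by rewrite addr0.
  have [Si | _] := eqVneq (S i i) 0; first by rewrite W0 ?addr0 //; right.
  by have [ij | _] := eqVneq i j; rewrite add0r // W0 //; left.
- apply: (svd_differential_dS orthU orthV diagS dsvd) => i; last exact: Y0.
  by apply: W0 => //; left.
- rewrite (svd_differential_compl_svdSinv orthV orthU diagS dsvd' compV0).
  rewrite {1}[dV](frame_split V); congr (V *m _ + _); apply/matrixP => i j.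
  (* [dA] is a double adjoint here, so this is the formula for the adjoint
     decomposition. *)
  rewrite [X in hadamard _ X]addrC -[in X in _ + X](trmxCK dA).
  rewrite (hadamard_svdF orthV orthU diagS posS dsvd').
  by case: eqP => // /Y0.
Qed.

Lemma svd_formula_gauge :
  svd_gauge U S V
    (U *m (hadamard (svdF S)
             (U^t* *m dA *m V *m S + S *m V^t* *m dA^t* *m U)
           + hadamard (svdT S) (U^t* *m dA *m V))
     + (1%:M - U *m U^t*) *m dA *m V *m svdSinv S)
    (V *m hadamard (svdF S)
            (S *m U^t* *m dA *m V + V^t* *m dA^t* *m U *m S)
     + (1%:M - V *m V^t*) *m dA^t* *m U *m svdSinv S).
Proof.
have F0 M i j : S i i = S j j -> hadamard (svdF S) M i j = 0.
  by move=> Sij; rewrite mxE [svdF S i j]mxE Sij eqxx mul0r.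
rewrite -(mulmxA (1%:M - _) dA V) -(mulmxA (1%:M - _) (dA^t*) U).
apply: svd_gauge_coord => [i j /F0 -> // | i j Sij ij].
rewrite mxE F0 // add0r mxE [svdT S i j]mxE.
by case: ij => ->; rewrite !eqxx ?andbF mul0r.
Qed.

(** The coordinates [W], [Y], [D] enter the product rule only through one
    [k x k] block, and [L], [N] only through [L *m S] and [N *m S].  Hence two
    differentials agreeing on these three matrices have the same [dA]. *)
Lemma svd_product_rule_coord (W Y D : 'M[C]_k) (L : 'M[C]_(m, k))
    (N : 'M[C]_(n, k)) :
  (U *m W + L) *m S *m V^t* + U *m D *m V^t* + U *m S *m (V *m Y + N)^t*
  = U *m (W *m S + D + S *m Y^t*) *m V^t* + L *m S *m V^t*
    + U *m (N *m S)^t*.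
Proof.
have adjS : S^t* = S by apply: diag_real_trmxC => // i; rewrite ger0_real.
rewrite trmxCD !trmxC_mul adjS !(mulmxDl, mulmxDr) !mulmxA addrA.
by congr (_ + _); rewrite -!addrA; congr (_ + _); rewrite addrC -addrA.
Qed.

(** Only the entries of [W] and [Y] within equal singular values are changed.
    There [P_ij] constrains just [s_i (W_ij - Y_ij)] off the diagonal, so
    replacing [(W_ij, Y_ij)] by [(W_ij - Y_ij, 0)], or by [(0, 0)] when
    [s_i = 0], preserves [P]; on the diagonal [dS] absorbs the change. *)
Lemma svd_gauge_exists :
  (forall i, (U^t* *m dA *m V) i i \is Num.real) ->
  exists (dU' : 'M[C]_(m, k)) (dS' : 'M[C]_k) (dV' : 'M[C]_(n, k)),
    svd_differential U S V dA dU' dS' dV' /\ svd_gauge U S V dU' dV'.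
Proof.
move=> realP; have [defdA skewU skewV diagdS _] := dsvd.
have /eqP := skewV; rewrite addr_eq0 => /eqP adjY.
have coreE := svd_differential_coreE orthU orthV diagS dsvd.
have core : U^t* *m dA *m V
    = U^t* *m dU *m S + dS + S *m (V^t* *m dV)^t*.
  rewrite (svd_differential_core orthU orthV dsvd) trmxC_mul trmxCK adjY.
  by rewrite mulmxN.
move/frame_skewE: skewU => skewW; move/frame_skewE: (skewV) => skewY.
set P := U^t* *m dA *m V in realP core coreE.
pose W' : 'M[C]_k := \matrix_(i, j)
  if S i i != S j j then (U^t* *m dU) i j
  else if (i == j) || (S i i == 0) then 0
  else (U^t* *m dU) i j - (V^t* *m dV) i j.
pose Y' : 'M[C]_k := \matrix_(i, j)
  if S i i == S j j then 0 else (V^t* *m dV) i j.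
have skewW' i j : (W' j i)^* = - W' i j.
  rewrite [W' i j]mxE [W' j i]mxE [S j j == _]eq_sym [j == i]eq_sym.
  case: eqVneq => [-> | _] /=; last exact: skewW.
  by case: ifP => _; rewrite ?rmorph0 ?oppr0 // rmorphB /= skewW skewY opprD.
have skewY' i j : (Y' j i)^* = - Y' i j.
  rewrite [Y' i j]mxE [Y' j i]mxE eq_sym.
  by case: eqP => _; rewrite ?rmorph0 ?oppr0 ?skewY.
have core' : P = W' *m S + hadamard 1%:M P + S *m Y'^t*.
  have -> : Y'^t* = - Y'.
    by apply/matrixP => i j; rewrite [RHS]mxE -skewY' [LHS]mxE [in LHS]mxE.
  apply/matrixP => i j; rewrite mulmxN.
  have entryE (X Y Z : 'M[C]_k) : (X + Y - Z) i j = X i j + Y i j - Z i j.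
    by rewrite !mxE.
  rewrite entryE mulmx_diagE // diag_mulmxE //.
  have [<- | ij] := eqVneq i j.
    by rewrite hadamard1E [W' i i]mxE [Y' i i]mxE !eqxx /= mul0r mulr0 add0r subr0.
  rewrite (is_diag_mxP (hadamard1_is_diag _)) // coreE.
  rewrite (is_diag_mxP diagdS) // [W' i j]mxE [Y' i j]mxE (negPf ij) /=.
  have [<- | _] //= := eqVneq (S i i) (S j j).
  by case: eqP => [-> | _]; ring.
(* [_ *m S *m svdSinv S] erases the columns of the singular value 0, as the
   gauge demands, and is invisible after multiplication by [S]. *)
exists (U *m W' + (1%:M - U *m U^t*) *m (dU *m S) *m svdSinv S).
exists (hadamard 1%:M P).
exists (V *m Y' + (1%:M - V *m V^t*) *m (dV *m S) *m svdSinv S).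
split; last first.
  apply: svd_gauge_coord => [i j Sij | i j Sij ij]; rewrite mxE Sij eqxx //=.
  by case: ij => [-> | <-]; rewrite -?Sij eqxx ?orbT.
split.
- rewrite svd_product_rule_coord -core' !(mulmxA _ _ S) !mulmx_diag_svdSinvK //.
  rewrite core {1}defdA {1}(frame_split U dU) {1}(frame_split V dV).
  by rewrite svd_product_rule_coord.
- by apply/frame_skewE; rewrite -mulmxA frame_coord.
- by apply/frame_skewE; rewrite -mulmxA frame_coord.
- exact: hadamard1_is_diag.
- by move=> i; rewrite hadamard1E.
Qed.

End Gauge.

End Differential.

(** * The differentials of the singular value decomposition *)

Theorem theorem3p1 (C : numClosedFieldType) (m n k : nat)
    (A : 'M[C]_(m, n)) (U : 'M[C]_(m, k)) (S : 'M[C]_k) (V : 'M[C]_(n, k))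
    (svdA : is_svd A U S V)
    (rank_lt : (\rank A < k)%N) (k_lt : (k < minn m n)%N)
    (dA : 'M[C]_(m, n)) (dU : 'M[C]_(m, k)) (dS : 'M[C]_k) (dV : 'M[C]_(n, k))
    (dsvd : svd_differential U S V dA dU dS dV) :
  (svd_gauge U S V dU dV <->
   [/\ dU = U *m (hadamard (svdF S)
                    (U^t* *m dA *m V *m S + S *m V^t* *m dA^t* *m U)
                  + hadamard (svdT S) (U^t* *m dA *m V))
            + (1%:M - U *m U^t*) *m dA *m V *m svdSinv S,
       dS = hadamard 1%:M (U^t* *m dA *m V)
     & dV = V *m hadamard (svdF S)
                   (S *m U^t* *m dA *m V + V^t* *m dA^t* *m U *m S)
            + (1%:M - V *m V^t*) *m dA^t* *m U *m svdSinv S])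
  /\ ((forall i, (U^t* *m dA *m V) i i \is Num.real) ->
      exists (dU' : 'M[C]_(m, k)) (dS' : 'M[C]_k) (dV' : 'M[C]_(n, k)),
        svd_differential U S V dA dU' dS' dV' /\ svd_gauge U S V dU' dV').
Proof.
have [_ orthU orthV diagS posS] := svdA.
split; last exact: (svd_gauge_exists orthU orthV diagS posS dsvd).
split=> [gauge | [-> _ ->]].
  exact: (svd_gauge_formula orthU orthV diagS posS dsvd gauge).
exact: svd_formula_gauge.
Qed.
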